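(* Let $(\Omega,\mu)$ be a finite measure space with $\mu(\Omega)>0$, and let $S_1,\dots,S_k\subseteq\Omega$ be measurable sets such that $\mu(S_i)>0$ for every $i$ and $\mu(S_i\triangle S_j)>0$ for all $i\neq j$. Consider the set elimination game on $S_1,\dots,S_k$ (defined in the context). Then $$\mathbf{E}\big[\mu(\mathrm{win})\big]\le (2\ln k+2)\cdot\min_{i\in[k]}\mu(S_i),$$ where $\mathrm{win}$ denotes the winner of the game.
   Context: Set elimination game: let $\omega_1,\omega_2,\dots$ be i.i.d. random elements of $\Omega$, each distributed according to the probability measure $\mu/\mu(\Omega)$. Set $\mathcal{R}_0=\{S_1,\dots,S_k\}$ and for $n\ge 1$: if there is some $S'\in\mathcal{R}_{n-1}$ with $\omega_n\notin S'$, then $\mathcal{R}_n=\mathcal{R}_{n-1}\setminus\{S\in\mathcal{R}_{n-1}:\omega_n\in S\}$; otherwise (all sets in $\mathcal{R}_{n-1}$ contain $\omega_n$) $\mathcal{R}_n=\mathcal{R}_{n-1}$. The winner $\mathrm{win}$ is the unique element of $\bigcap_{n\ge0}\mathcal{R}_n$ (which exists with probability $1$ under the stated assumptions). The cost of the game is $\mu(\mathrm{win})$. Here $\triangle$ denotes symmetric difference. *)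

(* Defs.v *)
From HB Require Import structures.
From mathcomp Require Import all_boot all_order all_algebra finmap.
From mathcomp Require Import all_classical all_reals all_analysis.

Set Implicit Arguments.
Unset Strict Implicit.
Unset Printing Implicit Defensive.

Import Order.TTheory GRing.Theory Num.Theory.

Local Open Scope classical_set_scope.
Local Open Scope ring_scope.
Local Open Scope ereal_scope.

(* The sequence is indexed from 0: [w m] is the (m+1)-st point drawn. *)
Fixpoint remaining {T : Type} (R0 : set (set T)) (w : nat -> T) (n : nat) :
    set (set T) :=
  if n is m.+1 then
    let R := remaining R0 w m in
    if `[< exists2 S', R S' & ~ S' (w m) >]
    then R `\` [set S | R S /\ S (w m)]
    else R
  else R0.

(* When the intersection is not a singleton (a null event for the games
   considered here) the value is the whole space, the costliest set. *)
Definition winner {T : Type} (R0 : set (set T)) (w : nat -> T) : set T :=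
  xget setT [set W | \bigcap_n remaining R0 w n = [set W]].

Definition mutually_independent d d' (O : measurableType d)
    (T : measurableType d') (R : realType) (P : probability O R)
    (X : nat -> {RV P >-> T}) : Prop :=
  forall (J : {fset nat}) (A : nat -> set T),
    (forall n, n \in J -> measurable (A n)) ->
    P (\bigcap_(n in [set` J]) (X n @^-1` A n)) =
    \prod_(n <- J) P (X n @^-1` A n).

Definition iid_with_law d d' (O : measurableType d) (T : measurableType d')
    (R : realType) (P : probability O R) (X : nat -> {RV P >-> T})
    (nu : set T -> \bar R) : Prop :=
  mutually_independent X /\
  forall n A, measurable A -> distribution P (X n) A = nu A.

(* Main.v *)
Require Import Defs.
From HB Require Import structures.
From mathcomp Require Import all_boot all_order all_algebra finmap.
From mathcomp Require Import ring lra zify.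
From mathcomp Require Import all_classical all_reals all_analysis.
From mathcomp Require Import measurable_realfun.

(* Fix a set S_0 among the S_i and let q_i be the probability of S_i \ S_0,
   so that P(S_i) <= P(S_0) + q_i: it is enough to bound the expectation of
   q_win on the event that S_0 is eliminated. Suppose that the n-th point,
   which lies in S_0, eliminates S_0. Delete it from the sequence. The
   winner i is then also the winner of the game played by the remaining
   points on the sets avoiding the deleted point, a game that does not
   depend on n; moreover the first n - 1 points avoid S_i \ S_0. By
   independence, the sum over n is therefore at most P(S_0) times the
   expectation of q_i A_i for the winner i of that smaller game, A_i being
   the first hitting time of S_i \ S_0. Each A_i is geometric of parameter
   q_i, so the largest of the k - 1 variables q_i A_i has expectation at
   most 1 + ln k + (k - 1) / k <= 1 + 2 ln k.

   The game sees a point only through the set of indices of the S_i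
   containing it, so this is a computation on words over a finite alphabet. *)

Import Order.TTheory GRing.Theory Num.Theory.
Import numFieldNormedType.Exports.

Local Open Scope ring_scope.

(** * The elimination game on a finite set of indices *)

Section Elimination.
Import mathcomp.boot.fintype mathcomp.boot.finset.
Context {I : finType}.
Implicit Types (A K y : {set I}) (s : seq {set I}).

Definition eliminate A y := if A \subset y then A else A :\: y.

Definition play A s := foldl eliminate A s.

Lemma play_cat A s1 s2 : play A (s1 ++ s2) = play (play A s1) s2.
Proof. exact: foldl_cat. Qed.

Lemma play_rcons A s y : play A (rcons s y) = eliminate (play A s) y.
Proof. exact: foldl_rcons. Qed.

Lemma eliminate_sub A y : eliminate A y \subset A.
Proof. by rewrite /eliminate; case: ifP => // _; exact: subsetDl. Qed.

Lemma play_sub A s : play A s \subset A.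
Proof.
elim: s A => [//|y s IH] A /=.
exact: subset_trans (IH _) (eliminate_sub A y).
Qed.

Lemma eliminate_neq0 A y : A != set0 -> eliminate A y != set0.
Proof. by rewrite /eliminate; case: ifP => // /negbT; rewrite -setD_eq0. Qed.

Lemma play_neq0 A s : A != set0 -> play A s != set0.
Proof. by elim: s A => [//|y s IH] A A0 /=; apply: IH; apply: eliminate_neq0. Qed.

(** If the round eliminates something, a survivor in [K] lies outside [y], so the round played on
    [A :&: K] eliminates too and both rounds subtract [y]. *)
Lemma eliminateI A K y : eliminate A y :&: K != set0 ->
  eliminate (A :&: K) y = eliminate A y :&: K.
Proof.
rewrite /eliminate; case: ifPn => [Ay _|_ /set0Pn[i]].
  by rewrite (subset_trans (subsetIl A K) Ay).
rewrite !inE => /andP[/andP[iy iA] iK]; rewrite ifN ?setIDAC//.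
by apply/subsetPn; exists i; rewrite // inE iA.
Qed.

Lemma eliminate_agree A y i j :
  i \in eliminate A y -> j \in eliminate A y -> (i \in y) = (j \in y).
Proof.
rewrite /eliminate; case: ifPn => [/subsetP Ay iA jA|_]; first by rewrite !Ay.
by rewrite !inE => /andP[/negPf-> _] /andP[/negPf-> _].
Qed.

(** A letter separating two remaining indices eliminates one of them. This makes long undecided
    games improbable. *)
Lemma play_agree A s i j : i \in play A s -> j \in play A s ->
  all (fun y : {set I} => (i \in y) == (j \in y)) s.
Proof.
elim: s A => [//|y s IH] A /= iP jP; rewrite (IH _ iP jP) andbT.
have sub := subsetP (play_sub (eliminate A y) s).
by rewrite (@eliminate_agree A y i j) ?sub.
Qed.

(* [y] is the point that eliminates [i0]. Deleting it and playing with the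
   sets that avoid it leaves the winner unchanged. *)
Lemma play_lost A s i0 i : i0 \in A -> play A s = [set i] -> i != i0 ->
  exists a y b, [/\ s = a ++ y :: b, i0 \in y,
    all (fun z : {set I} => (i \in z) ==> (i0 \in z)) a &
    play (A :&: ~: y) (a ++ b) = [set i]].
Proof.
elim: s A => [A i0A /= AE|x s IH A i0A /= sE] ii0.
  by move: i0A; rewrite AE inE eq_sym (negPf ii0).
have iAx : i \in eliminate A x.
  by apply: (subsetP (play_sub _ s)); rewrite sE set11.
have [i0Ax|i0Ax] := boolP (i0 \in eliminate A x).
  have [a [y [b [-> i0y aP abE]]]] := IH _ i0Ax sE ii0.
  exists (x :: a), y, b; split => //=.
    (* Both [i] and [i0] survive the letter [x], which therefore contains both or neither. *)
    by rewrite aP andbT (eliminate_agree _ _ _ _ iAx i0Ax) implybb.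
  rewrite eliminateI//; apply/set0Pn; exists i.
  by apply: (subsetP (play_sub _ (a ++ b))); rewrite abE set11.
exists [::], x, s; split => //.
  move: i0Ax; rewrite /eliminate; case: ifP => _; rewrite ?inE i0A //=.
  by rewrite andbT negbK.
move: i0Ax sE; rewrite /eliminate; case: ifP => _; first by rewrite i0A.
by rewrite setDE.
Qed.

End Elimination.

(** * Finite words with independent letters *)

Section Words.
Context {R : realType} {Y : finType} (w : Y -> R).

(* The expectation of [f] over words of [N] letters drawn independently with
   weights [w]. *)
Fixpoint Ew N (f : seq Y -> R) : R :=
  if N is M.+1 then \sum_y w y * Ew M (fun s => f (y :: s)) else f [::].

(** The recursion suits induction on the first letter; the sum over tuples gives linearity and
    monotonicity, and matches the law of the drawn points. *)
Lemma EwE N f : Ew N f = \sum_(t : N.-tuple Y) (\prod_(y <- t) w y) * f t.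
Proof.
elim: N f => [|N IH] f /=.
  rewrite (bigD1 [tuple])//= big_nil mul1r big1 ?addr0// => t.
  by rewrite (tuple0 t) => /eqP.
under eq_bigr do rewrite IH big_distrr/=.
rewrite pair_bigA/=.
rewrite (reindex (fun t : N.+1.-tuple Y => (thead t, [tuple of behead t])))/=.
  by apply: eq_bigr => t _; case/tupleP: t => y t; rewrite theadE /= big_cons mulrA.
exists (fun p : Y * N.-tuple Y => [tuple of p.1 :: p.2]) => [t _|[y t] _].
  by rewrite -tuple_eta.
by rewrite theadE; congr pair; apply: val_inj.
Qed.

Lemma Ew_sum (J : Type) (r : seq J) (Q : pred J) N (f : J -> seq Y -> R) :
  Ew N (fun s => \sum_(j <- r | Q j) f j s) = \sum_(j <- r | Q j) Ew N (f j).
Proof.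
rewrite EwE; under [RHS]eq_bigr do rewrite EwE.
by rewrite exchange_big/=; apply: eq_bigr => t _; rewrite big_distrr.
Qed.

Lemma EwZ N c f : Ew N (fun s => c * f s) = c * Ew N f.
Proof.
rewrite !EwE big_distrr/=; apply: eq_bigr => t _.
by rewrite mulrCA.
Qed.

Lemma EwD N f g : Ew N (fun s => f s + g s) = Ew N f + Ew N g.
Proof. by rewrite !EwE -big_split/=; apply: eq_bigr => t _; rewrite mulrDr. Qed.

Lemma eq_Ew N f g : (forall s, size s = N -> f s = g s) -> Ew N f = Ew N g.
Proof.
by move=> fg; rewrite !EwE; apply: eq_bigr => t _; rewrite fg ?size_tuple.
Qed.

(** By independence the letter in position [n] can be drawn apart, and the law of the other [N]
    letters does not depend on [n]. *)
Lemma Ew_insert N n f : (n <= N)%N ->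
  Ew N.+1 f = \sum_y w y * Ew N (fun s => f (take n s ++ y :: drop n s)).
Proof.
elim: n N f => [|n IH] N f.
  move=> _; apply: eq_bigr => y _; congr (_ * _).
  by apply: eq_Ew => s _; rewrite take0 drop0.
case: N => // N; rewrite ltnS => nN.
rewrite -[LHS]/(\sum_x w x * Ew N.+1 (fun s => f (x :: s))).
under eq_bigr do rewrite IH // big_distrr/=.
rewrite exchange_big; apply: eq_bigr => y _ /=; rewrite big_distrr/=.
by apply: eq_bigr => x _; rewrite mulrCA.
Qed.

Hypothesis w_ge0 : forall y, 0 <= w y.

Lemma le_Ew N f g : (forall s, size s = N -> f s <= g s) -> Ew N f <= Ew N g.
Proof.
move=> fg; rewrite !EwE; apply: ler_sum => t _; apply: ler_wpM2l.
  exact: prodr_ge0.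
by rewrite fg ?size_tuple.
Qed.

Hypothesis w_sum1 : \sum_y w y = 1.

Lemma Ew_cst N c : Ew N (fun=> c) = c.
Proof.
elim: N => [//|N IH] /=; under eq_bigr do rewrite IH.
by rewrite -big_distrl/= w_sum1 mul1r.
Qed.

Lemma Ew_all_take N n (a : pred Y) : (n <= N)%N ->
  Ew N (fun s => (all a (take n s))%:R) = (\sum_(y | a y) w y) ^+ n.
Proof.
elim: n N => [|n IH] N.
  by move=> _; under eq_Ew do rewrite take0; rewrite Ew_cst expr0.
case: N => // N; rewrite ltnS => nN; rewrite exprS -(IH _ nN) big_distrl/=.
rewrite [RHS]big_mkcond/=; apply: eq_bigr => y _; case: ifP => _.
  by congr (_ * _); apply: eq_Ew.
by rewrite (eq_Ew _ _ (fun=> 0)) ?Ew_cst ?mulr0.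
Qed.

End Words.

(** * Elementary estimates for the hitting times *)

Lemma sum_lt_ord (N m : nat) : (\sum_(n < N) (n < m) <= m)%N.
Proof.
suff -> : (\sum_(n < N) (n < m) = minn N m)%N by rewrite geq_minr.
by elim: N => [|N IH]; [rewrite big_ord0 min0n|rewrite big_ord_recr/= IH; lia].
Qed.

(** With [n0] the integer part of [L / q], the sum telescopes to at most [(1 - q) ^+ n0], hence to
    at most [expR (- q * n0%:R)]. Rounding down loses at most [q <= 1] in the exponent, whence the
    1. *)
Lemma geometric_tail {R : realType} (L q : R) (N : nat) : 0 <= L -> 0 <= q <= 1 ->
  \sum_(n < N | (Num.truncn (L / q) <= n)%N) q * (1 - q) ^+ n <= expR (1 - L).
Proof.
move=> L0 /andP[q0 q1]; set n0 := Num.truncn _.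
have [->|qn0] := eqVneq q 0.
  by rewrite big1 ?expR_ge0// => n _; rewrite mul0r.
have telescope : \sum_(n < N | (n0 <= n)%N) q * (1 - q) ^+ n <= (1 - q) ^+ n0.
  have [n0N|Nn0] := leqP n0 N; last first.
    rewrite big_pred0 ?exprn_ge0 ?subr_ge0// => n.
    by apply: contraTF (ltn_ord n) => n0n; rewrite -leqNgt (leq_trans (ltnW Nn0)).
  rewrite -(big_geq_mkord n0 N xpredT (fun n => q * (1 - q) ^+ n)).
  rewrite (eq_big_nat _ _ (F2 := fun n => (- (1 - q) ^+ n.+1) - (- (1 - q) ^+ n))).
    rewrite telescope_sumr// opprK addrC lerBlDr lerDl exprn_ge0// subr_ge0//.
  by move=> n _; rewrite exprS; ring.
apply: le_trans telescope _.
have q_gt0 : 0 < q by rewrite lt_neqAle eq_sym qn0.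
have decay : (1 - q) ^+ n0 <= expR (- q * n0%:R).
  rewrite expRM_natr lerXn2r ?nnegrE ?expR_ge0 ?subr_ge0//.
  exact: expR_ge1Dx.
apply: le_trans decay _; rewrite ler_expR mulNr lerNl opprB.
have : L / q < n0.+1%:R := truncnS_gt _.
by rewrite ltr_pdivrMr// -natr1 mulrDl mul1r mulrC; lra.
Qed.

(** * The bound for words of fixed length *)

Section Price.
Context {R : realType} {I : finType} (w : {set I} -> R).
Hypothesis w_ge0 : forall y, 0 <= w y.
Hypothesis w_sum1 : \sum_y w y = 1.

Definition mass i := \sum_(y : {set I} | i \in y) w y.

Variable i0 : I.

(** The parameter [q_i] of the geometric hitting time of [S_i \ S_0]. *)
Let excess i := \sum_(y : {set I} | (i \in y) && (i0 \notin y)) w y.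

Let follows i := fun y : {set I} => (i \in y) ==> (i0 \in y).

Let sum_pred_ge0 (Q : pred {set I}) : 0 <= \sum_(y | Q y) w y.
Proof. exact: sumr_ge0. Qed.

Let excess_le1 i : 0 <= excess i <= 1.
Proof.
rewrite sum_pred_ge0/= -w_sum1 /excess big_mkcond/=.
by apply: ler_sum => y _; case: ifP.
Qed.

Let sum_follows i : \sum_(y | follows i y) w y = 1 - excess i.
Proof.
rewrite -w_sum1 [X in X - _](bigID (follows i))/= -[LHS]addr0 -addrA.
congr (_ + _); apply/esym/eqP; rewrite subr_eq0; apply/eqP/eq_bigl => y.
by rewrite /follows; case: (i \in y); case: (i0 \in y).
Qed.

Let mass_excess i : mass i <= mass i0 + excess i.
Proof.
rewrite /mass (bigID (fun y : {set I} => i0 \in y))/= lerD2r.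
rewrite [leLHS]big_mkcond [leRHS]big_mkcond/=; apply: ler_sum => y _.
by case: (i0 \in y); rewrite ?andbT ?andbF //; case: ifP.
Qed.

(** Chosen so that [expR (1 - L)] is [#|I|%:R^-1]: the geometric tails of all [i != i0] then add up
    to less than 1. *)
Let L : R := 1 + ln #|I|%:R.

Definition won (A : {set I}) i (s : seq {set I}) : R := (play A s == [set i]%SET)%:R.

Let won_ge0 A i s : 0 <= won A i s. Proof. exact: ler0n. Qed.

Let indic_le1 (b : bool) : b%:R <= 1 :> R. Proof. by case: b. Qed.

Let sum_won A s : \sum_i won A i s <= 1.
Proof.
have [[i /eqP AsE]|none] := pselect (exists i, play A s == [set i]%SET).
  rewrite (bigD1 i)//= big1 => [|j ji]; first by rewrite addr0 indic_le1.
  rewrite /won (_ : (_ == _) = false)//; apply/negbTE/eqP => /setP/(_ i).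
  by rewrite AsE !inE eqxx eq_sym (negPf ji).
rewrite big1// => i _; rewrite /won (_ : (_ == _) = false)//.
by apply/negP => iP; apply: none; exists i.
Qed.

(* Position [n] stands for the point eliminating [i0], and the remaining word
   [s] no longer depends on [n]. The positions below [L / excess i] contribute
   at most [L] because at most one [i] wins the play of [s]; at the others only
   the fact that the first [n] letters avoid [excess i] is used. *)
Let price_after_loss A N :
  \sum_(n < N.+1) Ew w N (fun s => \sum_(i | i != i0) excess i *
     (won A i s * (all (follows i) (take n s))%:R))
  <= L + (1 - #|I|%:R^-1).
Proof.
(* When [excess i] is 0 the quotient is 0 by convention and every position is late; the factor
   [excess i] makes these terms vanish. *)
pose n0 i := Num.truncn (L / excess i).
have card_gt0 : 0 < #|I|%:R :> R by rewrite ltr0n; apply/card_gt0P; exists i0.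
have L_ge0 : 0 <= L by rewrite addr_ge0 ?ln_ge0// ler1n -(ltr0n R).
have n0_le i : excess i * (n0 i)%:R <= L.
  have [e0 _] := andP (excess_le1 i).
  have [->|en0] := eqVneq (excess i) 0; first by rewrite mul0r.
  rewrite mulrC -ler_pdivlMr ?lt_neqAle 1?eq_sym ?en0//.
  by rewrite truncn_le divr_ge0.
pose early n s := \sum_(i | i != i0) excess i * (won A i s * (n < n0 i)%N%:R).
pose late n s := \sum_(i | i != i0)
  excess i * ((n0 i <= n)%N%:R * (all (follows i) (take n s))%:R).
apply: (@le_trans _ _ (\sum_(n < N.+1) (Ew w N (early n) + Ew w N (late n)))).
  apply: ler_sum => n _; rewrite -EwD; apply: le_Ew => // s _.
  rewrite -big_split/=; apply: ler_sum => i _; rewrite -mulrDr.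
  have [e0 _] := andP (excess_le1 i); apply: ler_wpM2l => //.
  rewrite ltnNge; case: (n0 i <= n)%N => /=.
    by rewrite mulr0 add0r mul1r ler_piMl//; exact: indic_le1.
  by rewrite mulr1 mul0r addr0 ler_piMr//; exact: indic_le1.
rewrite big_split/=; apply: lerD.
  rewrite -Ew_sum -[leRHS](Ew_cst _ w_sum1 N); apply: le_Ew => // s _.
  rewrite exchange_big/=; apply: (@le_trans _ _ (\sum_i won A i s * L)); last first.
    by rewrite -big_distrl/= ler_piMl ?sum_won.
  rewrite big_mkcond/=; apply: ler_sum => i _; have [e0 _] := andP (excess_le1 i).
  case: ifP => _; last by rewrite mulr_ge0.
  under eq_bigr do rewrite mulrCA.
  rewrite -big_distrr/= ler_wpM2l// -big_distrr/=.
  apply: le_trans (n0_le i); rewrite ler_wpM2l// -natr_sum ler_nat.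
  exact: sum_lt_ord.
apply: (@le_trans _ _ (\sum_(i | i != i0) \sum_(n < N.+1 | (n0 i <= n)%N)
    excess i * (1 - excess i) ^+ n)).
  rewrite [leRHS](eq_bigr (fun i => \sum_(n < N.+1)
     excess i * ((n0 i <= n)%N%:R * (1 - excess i) ^+ n))); last first.
    move=> i _; rewrite big_mkcond/=; apply: eq_bigr => n _.
    by case: ifP; rewrite ?mul1r// mul0r mulr0.
  rewrite exchange_big/=; apply: ler_sum => n _; rewrite Ew_sum.
  apply: ler_sum => i _; rewrite (EwZ _ _ (excess i)) EwZ.
  by rewrite Ew_all_take// ?sum_follows// -ltnS.
apply: (@le_trans _ _ (\sum_(i | i != i0) expR (1 - L))).
  by apply: ler_sum => i _; exact: geometric_tail.
rewrite sumr_const cardC1 opprD addNKr expRN lnK ?posrE//.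
rewrite -[X in X <= _]mulr_natl -subn1 natrB; last by rewrite -(ltr0n R).
by rewrite mulrBl mul1r divff// gt_eqF.
Qed.

(** Indicator of a splitting as in [play_lost] with [a] of length [n]. Once letter [n] is fixed, the
    second factor depends on the other letters only, as [Ew_insert] requires. *)
Let lost (n : nat) (i : I) (s : seq {set I}) : R :=
  (i0 \in nth (@finset.set0 I) s n)%:R *
  (won (~: nth (@finset.set0 I) s n)%SET i (take n s ++ drop n.+1 s) *
   (all (follows i) (take n s))%:R).

Let won_lost N i s : size s = N -> i != i0 ->
  won [set: I]%SET i s <= \sum_(n < N) lost n i s.
Proof.
move=> sN ii0; rewrite {1}/won; case: eqP => [sE|_]; last first.
  by apply: sumr_ge0 => n _; rewrite !mulr_ge0.
have [a [y [b [sab i0y aP abE]]]] := play_lost _ _ _ _ (finset.in_setT i0) sE ii0.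
have aN : (size a < N)%N by rewrite -sN sab size_cat/= addnS ltnS leq_addr.
rewrite (bigD1 (Ordinal aN))//= -[leLHS]addr0 lerD//; last first.
  by apply: sumr_ge0 => n _; rewrite !mulr_ge0.
rewrite /lost sab nth_cat ltnn subnn/= take_size_cat// i0y mul1r aP mulr1.
rewrite -cat_rcons drop_size_cat ?size_rcons// /won.
by rewrite -(finset.setTI (~: y)%SET) abE eqxx.
Qed.

(** Undecided words cost nothing here; [undecided_bound] accounts for them. *)
Lemma price_bound N :
  Ew w N (fun s => \sum_i won [set: I]%SET i s * mass i)
  <= (2 * ln #|I|%:R + 2) * mass i0.
Proof.
have card_gt0 : 0 < #|I|%:R :> R by rewrite ltr0n; apply/card_gt0P; exists i0.
have mass_ge0 : 0 <= mass i0 by exact: sum_pred_ge0.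
apply: (@le_trans _ _ (mass i0 + \sum_(n < N) Ew w N (fun s =>
    \sum_(i | i != i0) excess i * lost n i s))).
  rewrite -{1}(Ew_cst _ w_sum1 N (mass i0)) -Ew_sum -EwD.
  apply: le_Ew => // s sN; rewrite exchange_big/=.
  (* The winner costs at most [mass i0], plus [excess i] if it is some [i != i0], in which case [i0]
     was lost. *)
  apply: (@le_trans _ _ (\sum_i won [set: I]%SET i s * (mass i0) +
      \sum_(i | i != i0) won [set: I]%SET i s * excess i)).
    rewrite (bigD1 i0)//= [X in _ <= X + _](bigD1 i0)//= -addrA lerD2l.
    rewrite -big_split/=; apply: ler_sum => i _.
    by rewrite -mulrDr ler_wpM2l.
  apply: lerD; first by rewrite -big_distrl/= ler_piMl ?sum_won.
  apply: ler_sum => i ii0; have [e0 _] := andP (excess_le1 i).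
  by rewrite mulrC -big_distrr/= ler_wpM2l// won_lost.
have loss : \sum_(n < N) Ew w N (fun s => \sum_(i | i != i0) excess i * lost n i s)
    <= mass i0 * (L + (1 - #|I|%:R^-1)).
  case: N => [|N].
    rewrite big_ord0 mulr_ge0// addr_ge0//.
      by rewrite addr_ge0 ?ln_ge0// ler1n -(ltr0n R).
    by rewrite subr_ge0 invf_le1// ler1n -(ltr0n R).
  (* Letter [n] is drawn apart: summing over the [y] containing [i0] yields the factor [mass i0],
     and for each such [y] the rest is bounded by [price_after_loss] on [~: y]. *)
  have insert (n : 'I_N.+1) :
      Ew w N.+1 (fun s => \sum_(i | i != i0) excess i * lost n i s) =
      \sum_y w y * (i0 \in y)%:R * Ew w N (fun s => \sum_(i | i != i0)
        excess i * (won (~: y)%SET i s * (all (follows i) (take n s))%:R)).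
    rewrite (@Ew_insert _ _ _ _ n) -1?ltnS//; apply: eq_bigr => y _.
    rewrite -mulrA; congr (_ * _); rewrite -EwZ; apply: eq_Ew => s sN.
    have nN : size (take n s) = n by rewrite size_takel// sN -ltnS.
    rewrite big_distrr/=; apply: eq_bigr => i _; rewrite mulrCA /lost.
    rewrite nth_cat nN ltnn subnn/= take_size_cat//.
    by rewrite -cat_rcons drop_size_cat ?size_rcons ?nN// cat_take_drop.
  under eq_bigr do rewrite insert.
  rewrite exchange_big/= big_distrl/= [leRHS]big_mkcond/=.
  apply: ler_sum => y _; rewrite -big_distrr/=.
  case: (i0 \in y); rewrite ?mulr1 ?mulr0 ?mul0r//.
  by apply: ler_wpM2l; [exact: w_ge0|exact: price_after_loss].
apply: le_trans (lerD (lexx _) loss) _.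
(* This turns the constant [1 + L + (1 - #|I|%:R^-1)] into [2 * ln #|I|%:R + 2]. *)
have : 1 - #|I|%:R^-1 <= ln #|I|%:R :> R.
  rewrite -[X in ln X]invrK lnV ?posrE ?invr_gt0// lerNr opprB.
  by rewrite -[X in ln X](subrK 1) addrC le_ln1Dx// ltrBrDr addNr invr_gt0.
rewrite /L => h; rewrite -{1}[mass i0]mulr1 -mulrDr mulrC ler_wpM2r//.
by lra.
Qed.

(** An undecided word leaves at least two indices, which by [play_agree] none of its letters
    separates; a union bound over ordered pairs concludes. *)
Lemma undecided_bound N :
  Ew w N (fun s => (~~ [exists i, play [set: I]%SET s == [set i]%SET])%:R) <=
  \sum_i \sum_(j | j != i)
    (\sum_(y : {set I} | (i \in y) == (j \in y)) w y) ^+ N.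
Proof.
pose agree i j := fun y : {set I} => (i \in y) == (j \in y).
apply: (@le_trans _ _ (Ew w N (fun s => \sum_i \sum_(j | j != i)
    (all (agree i j) s)%:R))); last first.
  rewrite Ew_sum; apply: ler_sum => i _; rewrite Ew_sum; apply: ler_sum => j _.
  rewrite -(@Ew_all_take _ _ _ w_sum1 N N (agree i j))//.
  by apply: le_Ew => // s <-; rewrite take_size.
apply: le_Ew => // s _; case: existsPn => [undecided|_]; last first.
  by apply: sumr_ge0 => i _; exact: sumr_ge0.
have /play_neq0 - /(_ s) /finset.set0Pn[i iA] : [set: I]%SET != finset.set0.
  by apply/finset.set0Pn; exists i0.
have [j jA ji] : exists2 j, j \in play [set: I]%SET s & j != i.
  have := undecided i; rewrite finset.eqEsubset finset.sub1set iA andbT.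
  by move=> /subsetPn[j jA]; rewrite inE => ji; exists j.
rewrite (bigD1 i)//= (bigD1 j)//= /agree (play_agree _ _ _ _ iA jA) -addrA lerDl.
by rewrite addr_ge0// sumr_ge0// => ? _; exact: sumr_ge0.
Qed.

End Price.

Local Open Scope classical_set_scope.
Local Open Scope ereal_scope.

(** * Integrals of functions with finitely many values *)

Section FinitelyValued.
Context {d} {T : measurableType d} {R : realType}.
Variable mu : {measure set T -> \bar R}.

(** Applied to the cost of the winner, whose measurability is not established. The integral is a
    supremum over simple functions, and those below [f] are below [g]. *)
Lemma ge0_le_integral_nonmeasurable (f g : T -> \bar R) :
  (forall x, 0 <= f x) -> (forall x, f x <= g x) ->
  \int[mu]_x f x <= \int[mu]_x g x.
Proof.
move=> f0 fg; have g0 x : 0 <= g x := le_trans (f0 x) (fg x).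
rewrite !ge0_integralTE//; apply: ereal_sup_le => _ [h /= hf <-].
by exists h => //= x; exact: le_trans (hf x) (fg x).
Qed.

Context {Y : finType} (f : T -> Y).
Hypothesis mf : forall y, measurable (f @^-1` [set y]).

Lemma integral_finType (G : Y -> R) : (forall y, (0 <= G y)%R) ->
  \int[mu]_x (G (f x))%:E = \sum_y (G y)%:E * mu (f @^-1` [set y]).
Proof.
move=> G0; have GE x : (G (f x))%:E =
    \sum_y (G y)%:E * (\1_(f @^-1` [set y]) x)%:E.
  rewrite (bigD1 (f x))//= indicE mem_set// mule1 big1 ?adde0// => y yfx.
  by rewrite indicE memNset ?mule0//= => /esym/eqP; apply/negP.
under eq_integral do rewrite GE.
rewrite ge0_integral_sum//.
- apply: eq_bigr => y _; rewrite ge0_integralZl_EFin//.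
  + by rewrite integral_indic// setIT.
  + exact/measurable_EFinP/measurable_indic.
- move=> y; apply: measurable_funeM; exact/measurable_EFinP/measurable_indic.
- by move=> y x _; rewrite mule_ge0// lee_fin.
Qed.

Lemma measure_finType (Q : pred Y) :
  mu [set x | Q (f x)] = \sum_(y | Q y) mu (f @^-1` [set y]).
Proof.
have mQ : measurable [set x | Q (f x)].
  rewrite (_ : [set x | _] = \big[setU/set0]_(y | Q y) (f @^-1` [set y])).
    by apply: bigsetU_measurable => y _.
  rewrite -bigcup_seq_cond; apply/seteqP; split; last first.
    by move=> x [y /= /andP[_ Qy] fxy]; rewrite fxy.
  move=> x Qx.
  by exists (f x) => //=; rewrite mem_index_enum.
rewrite -(setIT [set x | _]) -integral_indic//.
rewrite (eq_integral (fun x => (Q (f x))%:R%:E)); last first.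
  move=> x _; rewrite indicE; congr ((nat_of_bool _)%:R%:E).
  by apply/idP/idP; rewrite inE.
rewrite (integral_finType (fun y => (Q y)%:R))// [RHS]big_mkcond/=.
by apply: eq_bigr => y _; case: (Q y); rewrite ?mul1e ?mul0e.
Qed.

End FinitelyValued.

(** * Translation of the game on sets into the game on words *)

Section Signature.
Context {T : Type} {I : finType} (S : I -> set T).

Definition signature (t : T) : {set I} := [set i | `[< S i t >]]%SET.

(** Whether a round removes the index [j] depends only on [S j] and on the remaining family. *)
Lemma remaining_play (w : nat -> T) n :
  remaining (range S) w n = S @` [set` play [set: I]%SET (mkseq (signature \o w) n)].
Proof.
elim: n => [|n IH].
  by rewrite /=; congr image; apply/seteqP; split => // i _ /=; rewrite inE.
rewrite [LHS]/= {}IH mkseqS play_rcons.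
set A := play _ _; rewrite /eliminate.
have [Aw|/fintype.subsetPn[i iA iw]] := boolP (A \subset _).
  rewrite asboolF// => -[_ [i /= iA <-]]; apply.
  by have := fintype.subsetP Aw i iA; rewrite inE => /asboolP.
rewrite asboolT; last first.
  by exists (S i); [exists i|move: iw; rewrite inE => /asboolP].
apply/seteqP; split => [_ [[j /= jA <-] jw]|_ [j /= + <-]].
  exists j => //=; rewrite finset.inE jA andbT inE.
  by apply/asboolP => Sjw; apply: jw; split => //; exists j.
rewrite finset.inE => /andP[]; rewrite inE => /asboolP jw jA.
by split; [exists j|case].
Qed.

(** A lone index is never eliminated and was present at all earlier times, so [S i] always remains,
    while time [N] excludes every other set. *)
Lemma winner_play (w : nat -> T) N i :
  play [set: I]%SET (mkseq (signature \o w) N) = [set i]%SET ->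
  winner (range S) w = S i.
Proof.
move=> NE; have inA n : i \in play [set: I]%SET (mkseq (signature \o w) n).
  have cut m p : (m <= p)%N -> exists s,
      play [set: I]%SET (mkseq (signature \o w) p) =
      play (play [set: I]%SET (mkseq (signature \o w) m)) s.
    move=> mp; exists (map (signature \o w) (iota m (p - m))).
    by rewrite -play_cat -map_cat -iotaD subnKC.
  have [/cut[s sE]|/ltnW/cut[s sE]] := leqP n N.
    by apply: (fintype.subsetP (play_sub _ s)); rewrite -sE NE finset.set11.
  have i_neq0 : [set i]%SET != finset.set0.
    by apply/finset.set0Pn; exists i; rewrite finset.set11.
  rewrite sE NE; have := play_sub [set i]%SET s.
  rewrite finset.subset1 (negPf (play_neq0 _ s i_neq0)) orbF => /eqP ->.
  by rewrite finset.set11.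
have capE : \bigcap_n remaining (range S) w n = [set S i].
  apply/seteqP; split => [W /(_ N Logic.I)|_ -> n _]; last first.
    by rewrite remaining_play; exists i => //=.
  by rewrite remaining_play NE => -[j /=]; rewrite finset.inE => /eqP -> <-.
apply: xget_unique => //= W; rewrite capE => /seteqP[_ /(_ W)]; exact.
Qed.

(** Bounds the cost by [mu setT] even where the game is undecided. *)
Lemma winner_range (w : nat -> T) :
  winner (range S) w = setT \/ exists i, winner (range S) w = S i.
Proof.
rewrite /winner; case: xgetP => [W _ /= WE|_]; last by left.
right; have : (\bigcap_n remaining (range S) w n) W by rewrite WE.
move=> /(_ 0%N Logic.I)[i _ <-].
by exists i.
Qed.

End Signature.

(** * Law of the drawn word and passage to the infinite game *)

Lemma iid_word_law {R : realType} {d d'} {T : measurableType d}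
    {O : measurableType d'} {P : probability O R} (X : nat -> {RV P >-> T})
    (nu : set T -> \bar R) (Y : finType) (f : T -> Y) (p : Y -> R) (y0 : Y) :
  iid_with_law X nu ->
  (forall y, measurable (f @^-1` [set y])) ->
  (forall y, nu (f @^-1` [set y]) = (p y)%:E) ->
  forall N (t : N.-tuple Y),
  let W x := [tuple of [seq f (X n x) | n <- iota 0 N]] in
  measurable (W @^-1` [set t]) /\
  P (W @^-1` [set t]) = (\prod_(y <- t) p y)%R%:E.
Proof.
move=> [indep law] mf nuE N t W.
pose A n := f @^-1` [set nth y0 t n].
pose J := [fset n in iota 0 N]%fset.
have inJ n : (n \in J) = (n < N)%N by rewrite inE mem_iota.
have WE : W @^-1` [set t] = \bigcap_(n in [set` J]) (X n @^-1` A n).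
  apply/seteqP; split => [x /= Wx n /=|x /= AX].
    rewrite inJ => nN; rewrite /A/= -Wx (nth_map 0%N) ?size_iota//.
    by rewrite nth_iota.
  apply/val_inj/(@eq_from_nth _ y0) => [|n]; first by rewrite !size_tuple.
  rewrite size_tuple => nN; rewrite (nth_map 0%N) ?size_iota// nth_iota//.
  by apply: AX; rewrite /= inJ.
have mXA n : measurable (X n @^-1` A n).
  by apply: measurable_funPTI; exact: mf.
split; first by rewrite WE; apply: fin_bigcap_measurable => // n _.
rewrite WE indep; last by move=> n _; exact: mf.
rewrite (eq_bigr (fun n => (p (nth y0 t n))%:E)); last first.
  by move=> n _; rewrite -nuE -(law n)//; exact: mf.
rewrite prodEFin (perm_big (iota 0 N))/=; last first.
  by apply: uniq_perm; rewrite ?fset_uniq ?iota_uniq// => n; rewrite inJ mem_iota.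
by rewrite [in RHS](big_nth y0) size_tuple /index_iota subn0.
Qed.

Lemma measurable_signature {d} {T : measurableType d} {I : finType}
    (S : I -> set T) (mS : forall i, measurable (S i)) (y : {set I}) :
  measurable (signature S @^-1` [set y]).
Proof.
rewrite (_ : _ @^-1` _ =
    \bigcap_(i in [set: I]) (if i \in y then S i else ~` S i)).
  apply: fin_bigcap_measurable => // i _.
  by case: ifP => _ //; exact: measurableC.
apply/seteqP; split => [t /= <- i _|t /= tS].
  by case: ifPn; rewrite inE => /asboolP.
apply/setP => i; rewrite inE; apply/asboolP.
by have := tS i Logic.I; case: ifP.
Qed.

Theorem theorem1 (R : realType)
  (d : measure_display) (T : measurableType d)
  (mu : {finite_measure set T -> \bar R}) (mu_gt0 : 0 < mu setT)
  (k : nat) (k_gt0 : (0 < k)%N) (S : 'I_k -> set T)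
  (mS : forall i, measurable (S i))
  (S_gt0 : forall i, 0 < mu (S i))
  (S_diff : forall i j, i != j -> 0 < mu (S i `+` S j))
  (d' : measure_display) (O : measurableType d') (P : probability O R)
  (omega : nat -> {RV P >-> T})
  (omega_iid : iid_with_law omega (fun A => mu A / mu setT)) :
  'E_P[fun x => fine (mu (winner (range S) (fun n => omega n x)))]
    <= (2 * ln (k%:R : R) + 2)%:E * \big[mine/+oo]_(i < k) mu (S i).
Proof.
have muTfin : mu setT \is a fin_num := fin_num_measure mu _ measurableT.
pose M := fine (mu setT).
have M_gt0 : (0 < M)%R by rewrite fine_gt0// mu_gt0 ltey_eq muTfin.
have mcell := measurable_signature S mS.
pose cell y := signature S @^-1` [set y].
pose w y := (fine (mu (cell y)) / M)%R.
have wE y : mu (cell y) = (M * w y)%:E.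
  by rewrite /w mulrC divfK ?gt_eqF// fineK//; apply: fin_num_measure; exact: mcell.
have w_ge0 y : (0 <= w y)%R by rewrite divr_ge0 ?fine_ge0// ltW.
have sigE (Q : pred {set 'I_k}) :
    mu [set t | Q (signature S t)] = (M * \sum_(y | Q y) w y)%:E.
  rewrite measure_finType// big_distrr/= -sumEFin.
  by apply: eq_bigr => y _; rewrite -wE.
have w_sum1 : (\sum_y w y = 1)%R.
  apply: (mulfI (lt0r_neq0 M_gt0)); rewrite mulr1; apply: EFin_inj.
  by rewrite -(sigE predT) fineK//; congr (mu _); apply/seteqP.
have muS i : mu (S i) = (M * mass w i)%:E.
  rewrite -sigE; congr (mu _); apply/seteqP; split => t /=; rewrite inE.
    by move=> Sit; apply/asboolP.
  by move/asboolP.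
have nuE y : mu (cell y) / mu setT = (w y)%:E.
  by rewrite wE -(fineK muTfin) inver gt_eqF// -EFinM mulrAC divff ?gt_eqF// mul1r.
set E := 'E_P[_]; set C := (2 * _ + 2)%R.
(* The minimum is folded from [+oo], for which the bound holds because [C] is positive. *)
suff bound i0 : E <= C%:E * mu (S i0).
  have C_gt0 : (0 < C)%R.
    by rewrite ltr_wpDl// mulr_ge0// ln_ge0// ler1n.
  apply: (big_ind (fun x => E <= C%:E * x)) => // [|x y Ex Ey].
    by rewrite gt0_muley ?lte_fin// leey.
  by rewrite minElt; case: ifP.
pose undecided (s : seq {set 'I_k}) :=
  ~~ [exists i, play [set: 'I_k]%SET s == [set i]%SET].
(* After scaling by [M], an undecided word is charged the whole measure of the space, enough for any
   winner decided later and for the default [setT]. *)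
pose cost s : R := (\sum_i won [set: 'I_k]%SET i s * mass w i + (undecided s)%:R)%R.
pose agree i j : R := (\sum_(y : {set 'I_k} | (i \in y) == (j \in y)) w y)%R.
pose err N : R := (\sum_i \sum_(j | j != i) agree i j ^+ N)%R.
have mass_ge0 i : (0 <= mass w i)%R by exact: sumr_ge0.
have cost_ge0 s : (0 <= cost s)%R.
  by rewrite addr_ge0// sumr_ge0// => i _; rewrite mulr_ge0.
have winner_cost x N : (fine (mu (winner (range S) (fun n => omega n x))) <=
    M * cost [seq signature S (omega n x) | n <- iota 0 N])%R.
  rewrite /cost; case: (boolP (undecided _)) => [_|]; last first.
    rewrite negbK => /existsP[i /eqP sE].
    rewrite (winner_play S _ N i sE) muS/= addr0 ler_wpM2l ?(ltW M_gt0)//.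
    rewrite (bigD1 i)//= /won sE eqxx mul1r lerDl.
    by apply: sumr_ge0 => j _; rewrite mulr_ge0.
  have winner_le : mu (winner (range S) (fun n => omega n x)) <= mu setT.
    have [->//|[i ->]] := winner_range S (fun n => omega n x).
    by rewrite le_measure ?inE.
  apply: (@le_trans _ _ M).
    apply: fine_le => //.
    by rewrite ge0_fin_numE// (le_lt_trans winner_le)// ltey_eq muTfin.
  rewrite ler_peMr ?(ltW M_gt0)// lerDr; apply: sumr_ge0 => i _.
  by rewrite mulr_ge0.
have step N : E <= (M * (C * mass w i0 + err N))%:E.
  pose W x := [tuple of [seq signature S (omega n x) | n <- iota 0 N]].
  have law t : measurable (W @^-1` [set t]) /\
      P (W @^-1` [set t]) = (\prod_(y <- t) w y)%R%:E :=
    iid_word_law _ _ _ _ _ finset.set0 omega_iid mcell nuE N t.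
  rewrite /E unlock; apply: le_trans
    (ge0_le_integral_nonmeasurable P _ (fun x => (M * cost (W x))%:E) _ _) _.
  - by move=> x; rewrite lee_fin fine_ge0.
  - by move=> x; rewrite lee_fin; exact: winner_cost.
  rewrite (integral_finType P W _ (fun t => M * cost t)%R); last 2 first.
  - by move=> t; have [] := law t.
  - by move=> t; rewrite mulr_ge0// ltW.
  rewrite (eq_bigr (fun t : N.-tuple {set 'I_k} =>
      (M * ((\prod_(y <- t) w y) * cost t))%:E)%R); last first.
    move=> t _; have [_ lawt] := law t.
    by rewrite [X in _ * X]lawt -EFinM -mulrA [(cost _ * _)%R]mulrC.
  rewrite sumEFin -big_distrr/= -EwE lee_fin ler_wpM2l ?(ltW M_gt0)// EwD.
  apply: lerD; last exact: (undecided_bound w).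
  by have := price_bound w w_ge0 w_sum1 i0 N; rewrite card_ord.
(* The missing mass is the normalized measure of the symmetric difference, positive by [S_diff]. *)
have agree_lt1 i j : j != i -> (`|agree i j| < 1)%R.
  move=> ji; rewrite ger0_norm ?sumr_ge0// -w_sum1.
  rewrite [ltRHS](bigID (fun y : {set 'I_k} => (i \in y) == (j \in y)))/= ltrDl.
  rewrite -(pmulr_rgt0 _ M_gt0) -lte_fin -sigE.
  rewrite (_ : [set t | _] = S i `+` S j) ?S_diff 1?eq_sym//.
  rewrite setY_def; apply/seteqP; split => t /=; rewrite !inE.
    case: asboolP => Si; case: asboolP => Sj //= _; [left|right]; by [].
  by case=> -[Si Sj]; [rewrite (asboolT Si) asboolF|rewrite asboolF ?asboolT].
have err_cvg0 : err @ \oo --> (0 : R)%R.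
  have -> : (0 = \sum_(i < k) \sum_(j < k | j != i) 0 :> R)%R.
    by rewrite big1// => i _; rewrite big1.
  apply: cvg_big => [|i _]; first exact: add_continuous.
  apply: cvg_big => [|j ji]; first exact: add_continuous.
  exact/cvg_expr/agree_lt1.
have E_ge0 : 0 <= E.
  by rewrite /E unlock; apply: integral_ge0 => x _; rewrite lee_fin fine_ge0.
have Efin : E \is a fin_num.
  by rewrite ge0_fin_numE// (le_lt_trans (step 0%N))// ltry.
rewrite muS -EFinM -(fineK Efin) lee_fin mulrCA.
have lim : (M * (C * mass w i0 + err N))%R @[N --> \oo] --> (M * (C * mass w i0))%R.
  apply: cvgM; first exact: cvg_cst.
  by rewrite -{2}[(C * mass w i0)%R]addr0; apply: cvgD => //; exact: cvg_cst.
apply: (cvgr_to_ge lim); apply: nearW => N.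
by rewrite -lee_fin fineK.
Qed.
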